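(* Let $d\ge2$ be an integer and $\alpha>-\frac12$ a real number with $\alpha>\frac d2-1$. There exists a constant $c>0$, depending only on $\alpha$ and $d$, such that for every $x=(x',x_d)\in\mathbb{R}^d_+$ with $x_d>0$ and every $\varepsilon>0$, $$0\le\tau_x(\chi_{B^+(0,\varepsilon)})(-y',y_d)\le c\,\Big(\frac{\varepsilon}{x_d}\Big)^{2\alpha+1}\quad\text{for a.e. } y=(y',y_d)\in\mathbb{R}^d_+.$$
   Context: $\mathbb{R}^d_+=\mathbb{R}^{d-1}\times(0,+\infty)$; points are written $x=(x',x_d)$ with $x'=(x_1,\dots,x_{d-1})\in\mathbb{R}^{d-1}$, $x_d>0$. ''A.e.'' refers to the measure $d\nu_\alpha(x)=\frac{x_d^{2\alpha+1}}{(2\pi)^{\frac{d-1}{2}}2^\alpha\Gamma(\alpha+1)}\,dx$ (equivalently, Lebesgue measure). For $\varepsilon>0$, $B^+(0,\varepsilon)=B(0,\varepsilon)\cap\mathbb{R}^d_+$, where $B(0,\varepsilon)$ is the closed Euclidean ball of $\mathbb{R}^d$ with center $0$ and radius $\varepsilon$; $\chi_A$ is the characteristic function of $A$. For $x_d,y_d,\rho>0$ let $$W_\alpha(x_d,y_d,\rho)=\frac{\Gamma(\alpha+1)\,\big((x_d+y_d)^2-\rho^2\big)^{\alpha-\frac12}\big(\rho^2-(x_d-y_d)^2\big)^{\alpha-\frac12}}{2^{2\alpha-1}\sqrt{\pi}\,\Gamma(\alpha+\frac12)\,(x_dy_d\rho)^{2\alpha}}$$ if $|x_d-y_d|<\rho<x_d+y_d$,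 and $W_\alpha(x_d,y_d,\rho)=0$ otherwise. The Weinstein translation of $\chi_{B^+(0,\varepsilon)}$ by $x\in\mathbb{R}^d_+$ is given, for $y=(y',y_d)\in\mathbb{R}^d_+$, by $$\tau_x(\chi_{B^+(0,\varepsilon)})(-y',y_d)=\int_0^{+\infty}\chi_{B^+(0,\varepsilon)}(x'-y',\rho)\,W_\alpha(x_d,y_d,\rho)\,\rho^{2\alpha+1}\,d\rho.$$ *)

(* Defs.v *)
From HB Require Import structures.
From mathcomp Require Import all_boot all_order all_algebra.
From mathcomp Require Import all_classical all_reals all_analysis.
From mathcomp Require Import measurable_realfun.

Set Implicit Arguments.
Unset Strict Implicit.
Unset Printing Implicit Defensive.

Import Order.TTheory GRing.Theory Num.Theory.
Import numFieldNormedType.Exports.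

Local Open Scope classical_set_scope.
Local Open Scope ring_scope.

(** Vectors of R^n are [n.-tuple]s, which carry the product sigma-algebra, and
    a point x = (x', x_d) of R^d is the pair of x' in R^(d-1) and x_d in R. *)
Notation vect R n := (n.-tuple (measurableTypeR R)).
Notation Rpoint R d := (vect R d.-1 * measurableTypeR R)%type.

(** [d] cannot be inferred from [Rpoint R d], which only mentions [d.-1], hence it
    is an explicit argument below. *)
Section vectors.
Context {R : realType}.

Definition vadd n (u v : vect R n) : vect R n :=
  [tuple (tnth u i : R) + (tnth v i : R) | i < n].

Definition vopp n (u : vect R n) : vect R n :=
  [tuple - (tnth u i : R) | i < n].

Definition enorm (d : nat) (x : Rpoint R d) : R :=
  Num.sqrt (\sum_(i < d.-1) (tnth x.1 i : R) ^+ 2 + (x.2 : R) ^+ 2).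
Arguments enorm : clear implicits.

Definition half_space (d : nat) : set (Rpoint R d) := [set x | 0 < (x.2 : R)].
Arguments half_space : clear implicits.

Definition half_ball (d : nat) (eps : R) : set (Rpoint R d) :=
  [set x | enorm d x <= eps] `&` half_space d.

Lemma measurable_half_space d : measurable (half_space d).
Proof.
rewrite (_ : half_space d = snd @^-1` [set` `]0, +oo[%R]); last first.
  by apply/seteqP; split => x; rewrite /half_space /= in_itv /= andbT.
rewrite -[X in measurable X]setTI.
by apply: (@measurable_snd _ _ (vect R d.-1) (measurableTypeR R)).
Qed.

End vectors.
Arguments enorm {R} d x.
Arguments half_space {R} d.
Arguments half_ball {R} d eps.

Lemma sigma_finite_product d1 d2 (T1 : measurableType d1)
    (T2 : measurableType d2) (R : realType)
    (m1 : {sigma_finite_measure set T1 -> \bar R})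
    (m2 : {sigma_finite_measure set T2 -> \bar R}) :
  sigma_finite setT (m1 \x m2)%E.
Proof.
have /sigma_finiteP[F [TF ndF Foo]] := sigma_finiteT m1.
have /sigma_finiteP[G [TG ndG Goo]] := sigma_finiteT m2.
exists (fun n => F n `*` G n).
  rewrite -setXTT TF TG predeqE => -[x y]; split.
    move=> [/= [n _ Fnx] [k _ Gky]]; exists (maxn n k) => //; split.
    - by move: x Fnx; exact/subsetPset/ndF/leq_maxl.
    - by move: y Gky; exact/subsetPset/ndG/leq_maxr.
  by move=> [n _ []/= ? ?]; split; exists n.
move=> k; have [? ?] := Foo k; have [? ?] := Goo k.
split; first exact: measurableX.
by rewrite product_measure1E// lte_mul_pinfty// ge0_fin_numE.
Qed.

(** Lebesgue measure on R^n, by induction on n: the image of the product of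
    Lebesgue measure on R and Lebesgue measure on R^n under (t, u) |-> t :: u. *)
Section lebesgue_vect.
Context {R : realType}.

Section step.
Variables (n : nat) (m : {sigma_finite_measure set (vect R n) -> \bar R}).

Definition vcons (p : measurableTypeR R * vect R n) : vect R n.+1 :=
  [the n.+1.-tuple _ of p.1 :: p.2].

Lemma measurable_vcons : measurable_fun setT vcons.
Proof. exact: measurable_cons. Qed.

Definition lebesgue_step : set (vect R n.+1) -> \bar R :=
  pushforward ((@lebesgue_measure R) \x m)%E vcons.

Let lebesgue_step0 : lebesgue_step set0 = 0%E.
Proof. by rewrite /lebesgue_step /pushforward preimage_set0 measure0. Qed.

Let lebesgue_step_ge0 A : (0 <= lebesgue_step A)%E.
Proof. by rewrite /lebesgue_step /pushforward; apply: measure_ge0. Qed.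

Let mpre A : measurable A -> measurable (vcons @^-1` A).
Proof.
by move=> mA; rewrite -[X in measurable X]setTI; exact: measurable_vcons.
Qed.

Let lebesgue_step_sigma_additive : semi_sigma_additive lebesgue_step.
Proof.
move=> F mF tF mUF; rewrite /lebesgue_step /pushforward preimage_bigcup.
apply: measure_semi_sigma_additive.
- by move=> k; exact: mpre.
- apply/trivIsetP => /= i j _ _ ij; rewrite -preimage_setI.
  by move/trivIsetP : tF => /(_ _ _ _ _ ij) ->//; rewrite preimage_set0.
- by rewrite -preimage_bigcup; exact: mpre.
Qed.

HB.instance Definition _ := isMeasure.Build _ _ _ lebesgue_step
  lebesgue_step0 lebesgue_step_ge0 lebesgue_step_sigma_additive.

Let lebesgue_step_sigma_finite : sigma_finite setT lebesgue_step.
Proof.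
have [F FT Foo] := sigma_finite_product (@lebesgue_measure R) m.
pose g (u : vect R n.+1) : measurableTypeR R * vect R n :=
  (tnth u ord0, [tuple of behead u]).
have mg : measurable_fun setT g.
  apply: measurable_fun_pair; first exact: measurable_tnth.
  exact: measurable_behead.
have vK : cancel vcons g.
  by move=> [t u]; rewrite /g /vcons /=; congr pair; exact: val_inj.
exists (fun k => g @^-1` F k) => [|k].
  by rewrite -preimage_bigcup -FT preimage_setT.
have [mFk Fkoo] := Foo k; split.
  by rewrite -[X in measurable X]setTI; exact: mg.
rewrite /lebesgue_step /pushforward -comp_preimage.
by rewrite (_ : g \o vcons = id) ?preimage_id//; apply/funext => p /=; rewrite vK.
Qed.

HB.instance Definition _ := Measure_isSigmaFinite.Build _ _ _ lebesgue_step
  lebesgue_step_sigma_finite.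

End step.

Fixpoint lebesgue_vect n : {sigma_finite_measure set (vect R n) -> \bar R} :=
  match n with
  | 0 => \d_([tuple] : vect R 0)
  | n'.+1 => lebesgue_step (lebesgue_vect n')
  end.

Lemma lebesgue_vect_box n (A : 'I_n -> set (measurableTypeR R)) :
  (forall i, measurable (A i)) ->
  lebesgue_vect n [set u | forall i, A i (tnth u i)] =
  (\prod_(i < n) lebesgue_measure (A i))%E.
Proof.
elim: n => [|n IHn] in A * => mA.
  rewrite big_ord0 /= /dirac indicE (_ : _ \in _) //.
  by rewrite inE; case.
rewrite big_ord_recl /= /lebesgue_step /pushforward.
set B := [set u : vect R n | forall i, A (lift ord0 i) (tnth u i)].
have mB : measurable B.
  rewrite (_ : B = \bigcap_(i in [set: 'I_n]) (fun u => tnth u i) @^-1` A (lift ord0 i)).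
    apply: fin_bigcap_measurable => // i _.
    by rewrite -[X in measurable X]setTI; exact: measurable_tnth.
  by apply/seteqP; split => u /= Bu i => [_|]; exact: Bu.
rewrite (_ : _ @^-1` _ = A ord0 `*` B); first last.
  apply/seteqP; split => [[t u] /= H|[t u] /= [H0 H] i].
    split; first exact: (H ord0).
    by move=> i; have := H (lift ord0 i); rewrite tnthS.
  by case: (unliftP ord0 i) => [j|] ->; rewrite ?tnthS//; exact: H.
rewrite product_measure1E//; congr (_ * _)%E.
exact: (IHn (fun i => A (lift ord0 i))).
Qed.

End lebesgue_vect.

Section weinstein.
Context {R : realType}.
Implicit Types (alpha eps rho : R).

Definition Gamma (a : R) : R :=
  \int[@lebesgue_measure R]_(t in `]0, +oo[) (t `^ (a - 1) * expR (- t)).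

Lemma Gamma_ge0 a : 0 <= Gamma a.
Proof.
by apply: Rintegral_ge0 => t _; rewrite mulr_ge0 ?powR_ge0 ?expR_ge0.
Qed.

Section measure.
Variables (d : nat) (alpha : R).

Definition nu_density (x : Rpoint R d) : R :=
  (x.2 : R) `^ (2 * alpha + 1) /
  ((2 * pi) `^ ((d%:R - 1) / 2) * 2 `^ alpha * Gamma (alpha + 1)).

(** The measure nu_alpha of R^d_+, extended by 0 to R^d. *)
Definition nu (A : set (Rpoint R d)) : \bar R :=
  (\int[lebesgue_vect d.-1 \x @lebesgue_measure R]_(x in A `&` half_space d)
     (nu_density x)%:E)%E.

Let nu_density_ge0 x : (0 <= (nu_density x)%:E)%E.
Proof. by rewrite lee_fin divr_ge0 ?mulr_ge0 ?powR_ge0 ?Gamma_ge0. Qed.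

Let measurable_nu_density : measurable_fun setT (EFin \o nu_density).
Proof.
apply/measurable_EFinP; apply: measurable_funM => //.
apply: (measurableT_comp (measurable_powR _)).
exact: measurable_snd.
Qed.

Let nu0 : nu set0 = 0%E.
Proof. by rewrite /nu set0I integral_set0. Qed.

Let nu_ge0 A : (0 <= nu A)%E.
Proof. by apply: integral_ge0 => x _; exact: nu_density_ge0. Qed.

Let nu_sigma_additive : semi_sigma_additive nu.
Proof.
move=> F mF tF mUF; rewrite /nu setI_bigcupl.
apply: semi_sigma_additive_nng_induced => //.
- by move=> k; apply: measurableI => //; exact: measurable_half_space.
- by apply/trivIset_setIr.
- by rewrite -setI_bigcupl; apply: measurableI => //; exact: measurable_half_space.
Qed.

HB.instance Definition _ := isMeasure.Build _ _ _ nu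
  nu0 nu_ge0 nu_sigma_additive.

End measure.

Definition weinstein_kernel alpha (xd yd rho : R) : R :=
  if `|xd - yd| < rho < xd + yd then
    Gamma (alpha + 1) *
    ((xd + yd) ^+ 2 - rho ^+ 2) `^ (alpha - 1 / 2) *
    (rho ^+ 2 - (xd - yd) ^+ 2) `^ (alpha - 1 / 2) /
    (2 `^ (2 * alpha - 1) * Num.sqrt pi * Gamma (alpha + 1 / 2) *
     (xd * yd * rho) `^ (2 * alpha))
  else 0.

(** [weinstein_translation d alpha f x y] is tau_x(f)(y', y_d). *)
Definition weinstein_translation (d : nat) alpha (f : Rpoint R d -> R)
    (x y : Rpoint R d) : \bar R :=
  (\int[@lebesgue_measure R]_(rho in `]0%R, +oo[)
     (f (vadd x.1 y.1, rho) * weinstein_kernel alpha x.2 y.2 rho *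
      rho `^ (2 * alpha + 1))%:E)%E.

End weinstein.
Arguments nu {R} d alpha.
Arguments weinstein_translation {R} d alpha f x y.

(* Main.v *)
Require Import Defs.
From HB Require Import structures.
From mathcomp Require Import all_boot all_order all_algebra.
From mathcomp Require Import all_classical all_reals all_analysis.
From mathcomp Require Import measurable_realfun.
From mathcomp Require Import ring lra.

Set Implicit Arguments.
Unset Strict Implicit.
Unset Printing Implicit Defensive.

Import Order.TTheory GRing.Theory Num.Theory.
Import numFieldNormedType.Exports.

Local Open Scope classical_set_scope.
Local Open Scope ring_scope.

(** Write q = alpha + 1/2 > 0, l = |x_d - y_d| and u = x_d + y_d.  A point
    (x' - y', rho) of the half ball has rho <= eps, so the translation is at most
    the integral over l < rho < min(eps, u) of W_alpha(x_d, y_d, rho)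
    rho^(2 alpha + 1), which is a constant multiple of

      (x_d y_d)^(-2 alpha) rho (rho^2 - l^2)^(q - 1) (u^2 - rho^2)^(q - 1).

    The two bases are positive with sum u^2 - l^2 = 4 x_d y_d.  Hence one of them
    lies between 2 x_d y_d and 4 x_d y_d, and its power is comparable to
    (x_d y_d)^(q - 1) whatever the sign of q - 1
    ([weinstein_kernel_le]).  What remains is (x_d y_d)^(-q) times
    rho (rho^2 - l^2)^(q - 1) or rho (u^2 - rho^2)^(q - 1), and these have the
    elementary primitives (rho^2 - l^2)^q / 2q and - (u^2 - rho^2)^q / 2q.  The
    integrands may blow up at l or u, so the fundamental theorem of calculus is
    used on compact subintervals that exhaust ]l, u[
    ([integral_powR_sqr_le]).

    - If 2 eps < x_d, a nonempty range of integration forces y_d > x_d / 2, so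
      that rho^2 <= x_d^2 / 4 makes u^2 - rho^2 the large base throughout.  Its
      partner integrates to at most a multiple of eps^(2 q), while
      (x_d y_d)^(-q) is at most a multiple of x_d^(-2 q); their product is a
      multiple of (eps / x_d)^(2 alpha + 1)
      ([weinstein_translation_le_near]).
    - If x_d <= 2 eps, the right-hand side is bounded below, and the sum of both
      pieces over all of ]l, u[ is at most a multiple of
      (x_d y_d)^(-q) (u^2 - l^2)^q, a constant
      ([weinstein_translation_le_far]). *)

(** * Improper integrals over bounded open intervals *)

Section improper_integrals.
Context {R : realType}.
Local Notation mu := (@lebesgue_measure R).

(** A nonnegative function that is only known to be continuous inside ]l, u[ is
    integrated by monotone convergence over compact subintervals, where the
    fundamental theorem of calculus applies: bounded increments of a primitive
    suffice, and no limit of it at the end points is required. *)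
Lemma ge0_integral_oo_le_increment (F f : R -> R) (l u B : R) : 0 <= B ->
  (forall t, l < t < u -> is_derive t 1 F (f t)) ->
  (forall t, l < t < u -> {for t, continuous f}) ->
  (forall t, l < t < u -> 0 <= f t) ->
  (forall s t, l < s -> s < t -> t < u -> F t - F s <= B) ->
  (\int[mu]_(t in `]l, u[) (f t)%:E <= B%:E)%E.
Proof.
move=> B0 dF cf f0 FB.
have [ul|lu] := leP u l.
  by rewrite set_itv_ge ?integral_set0 ?lee_fin// bnd_simp -leNgt.
have mf : measurable_fun `]l, u[ f.
  apply: open_continuous_measurable_fun; first exact: interval_open.
  by move=> t; rewrite inE/= in_itv/=; exact: cf.
(* With the divisor n + 3 the compact intervals are never reduced to a point. *)
pose e n : R := (u - l) / n.+3%:R.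
have e0 n : 0 < e n by rewrite divr_gt0 ?subr_gt0.
have eanti m n : (m <= n)%N -> e n <= e m.
  by move=> mn; rewrite ler_pM2l ?subr_gt0// lef_pV2 ?posrE// ler_nat.
have e2 n : l + e n < u - e n.
  suff : e n + e n < u - l by lra.
  have : e n <= (u - l) / 3 by apply: (eanti 0%N).
  by have : 0 < u - l by [rewrite subr_gt0]; lra.
pose E n := `[l + e n, u - e n]%classic.
have Elu n t : E n t -> l < t < u.
  by rewrite /E/= in_itv/= => /andP[? ?]; have := e0 n; lra.
have -> : `]l, u[%classic = \bigcup_n E n.
  apply/seteqP; split => [t|t [n _ /Elu]]; rewrite /= in_itv//= => /andP[lt tu].
  pose m := Num.truncn ((u - l) / Num.min (t - l) (u - t)).
  have min0 : 0 < Num.min (t - l) (u - t) by rewrite lt_min !subr_gt0 lt.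
  exists m => //; rewrite /E/= in_itv/=.
  have : e m <= Num.min (t - l) (u - t).
    rewrite ler_pdivrMr// mulrC -ler_pdivrMr//.
    apply: ltW; apply: lt_trans (truncnS_gt _) _.
    by rewrite ltr_nat ltnS ltnW.
  by rewrite le_min; lra.
have mfE n : measurable_fun (E n) (EFin \o f).
  apply/measurable_EFinP; apply: measurable_funS mf => // t /Elu.
  by rewrite /= in_itv.
have cvgE : ((\int[mu]_(t in E n) (f t)%:E)%E @[n --> \oo] -->
             (\int[mu]_(t in \bigcup_n E n) (f t)%:E)%E).
  apply: ge0_nondecreasing_set_cvg_integral => //.
  - move=> m n mn; apply/subsetPset => t; rewrite /E/= !in_itv/=.
    by have := eanti _ _ mn; lra.
  - by move=> n; exact: measurable_itv.
  - by move=> n t /Elu; rewrite lee_fin; exact: f0.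
apply: cvge_to_le cvgE _.
apply: nearW => n.
rewrite (@continuous_FTC2 _ f F)//.
- by rewrite -EFinB lee_fin; apply: FB => //; have := e0 n; lra.
- by apply: continuous_in_subspaceT => t /set_mem /Elu; exact: cf.
- have dFE t : E n t -> derivable F t 1.
    by move=> /Elu /dF dFt; exact: ex_derive.
  have cF t : E n t -> {for t, continuous F}.
    by move=> /dFE /derivable1_diffP /differentiable_continuous.
  have [eL eR] : E n (l + e n) /\ E n (u - e n).
    by rewrite /E/= !in_itv/= !lexx !ltW.
  split.
  + by move=> t; rewrite in_itv/= => /andP[? ?]; apply: dFE; rewrite /E/= in_itv/= !ltW.
  + by apply: cvg_at_right_filter; exact: cF.
  + by apply: cvg_at_left_filter; exact: cF.
- move=> t /subset_itv_oo_cc /Elu /dF d.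
  by rewrite derive1E derive_val.
Qed.

(** The sign s treats the singularity at either end with one primitive,
    s (s (t^2 - a))^q / 2q: take s = 1 and a = l^2 for the lower end, s = -1 and
    a = u^2 for the upper one.  The primitive has constant sign and absolute
    value at most M^q / 2q, so its increments are at most that as well. *)
Lemma integral_powR_sqr_le (q s a l u M : R) : 0 < q -> s ^+ 2 = 1 -> 0 <= l ->
  (forall t, l < t < u -> 0 < s * (t ^+ 2 - a) <= M) ->
  (\int[mu]_(t in `]l, u[) (t * (s * (t ^+ 2 - a)) `^ (q - 1))%:E
     <= (M `^ q / (2 * q))%:E)%E.
Proof.
move=> q0 s1 l0 gM.
pose g (t : R) : R := s * (t ^+ 2 - a).
have dg (t : R) : is_derive t 1 g (s * (2 * t)).
  rewrite /g; apply: is_derive_eq.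
  rewrite /GRing.scale/=; ring.
have dgr (r t : R) : l < t < u ->
    is_derive t 1 (fun t => g t `^ r) (s * (2 * t) * (r * g t `^ (r - 1))).
  move=> /gM/andP[g0 _].
  have dp : is_derive (g t) 1 (fun z : R => z `^ r) (r * g t `^ (r - 1)).
    exact: is_derive1_powR.
  have d := is_derive1_comp dp (dg t).
  by rewrite mulrC; exact: d.
apply: (@ge0_integral_oo_le_increment (fun t => (s / (2 * q)) * g t `^ q)).
- by rewrite divr_ge0 ?powR_ge0// mulr_ge0// ltW.
- move=> t /(dgr q) d.
  apply: (is_derive_eq (is_deriveZ _ d)).
  rewrite /GRing.scale/= -/(g t).
  have q0' : q != 0 by rewrite gt_eqF.
  transitivity (s ^+ 2 * (t * g t `^ (q - 1))); last by rewrite s1 mul1r.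
  by field.
- move=> t tlu; have d := dgr (q - 1) _ tlu.
  apply: continuousM; first exact: cvg_id.
  by apply: differentiable_continuous; apply/derivable1_diffP; exact: ex_derive.
- by move=> t /andP[lt _]; rewrite mulr_ge0 ?powR_ge0// (le_trans l0)// ltW.
- move=> r t lr rt tu.
  have gq z : l < z < u -> 0 <= g z `^ q <= M `^ q.
    move=> /gM/andP[g0 gM']; rewrite powR_ge0/= ge0_ler_powR ?nnegrE//; first exact: ltW.
    - exact: ltW.
    - exact: le_trans (ltW g0) gM'.
  have /gq/andP[r0 rM] : l < r < u by lra.
  have /gq/andP[t0 tM] : l < t < u by lra.
  rewrite -mulrBr mulrAC ler_pM2r ?invr_gt0 ?mulr_gt0//.
  have : (s - 1) * (s + 1) = 0 by lra.
  move=> /eqP; rewrite mulf_eq0 => /orP[/eqP|/eqP] h.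
    by have -> : s = 1; lra.
  by have -> : s = -1; lra.
Qed.

Lemma measurable_mul_powR_sqr (s a r : R) (D : set R) :
  measurable_fun D (fun t : R => t * (s * (t ^+ 2 - a)) `^ r).
Proof.
apply: measurable_funTS; apply: measurable_funM => //.
apply: (measurableT_comp (measurable_powR _)).
by apply: measurable_funM => //; apply: measurable_funB => //; exact: measurable_funX.
Qed.

Lemma integral_scaled_powR_sqr_le (k q s a l u M : R) :
  0 <= k -> 0 < q -> s ^+ 2 = 1 -> 0 <= l ->
  (forall t, l < t < u -> 0 < s * (t ^+ 2 - a) <= M) ->
  (\int[mu]_(t in `]l, u[) (k * (t * (s * (t ^+ 2 - a)) `^ (q - 1)))%:E
     <= (k * (M `^ q / (2 * q)))%:E)%E.
Proof.
move=> k0 q0 s1 l0 gM.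
under eq_integral do rewrite EFinM.
rewrite ge0_integralZl_EFin//.
- by rewrite EFinM lee_wpmul2l ?lee_fin//; exact: integral_powR_sqr_le.
- move=> t; rewrite /= in_itv/= => /andP[lt _].
  by rewrite lee_fin mulr_ge0 ?powR_ge0// (le_trans l0)// ltW.
- apply/measurable_EFinP.
  exact: measurable_mul_powR_sqr.
Qed.

End improper_integrals.

(** * The Weinstein kernel *)

Section kernel.
Context {R : realType}.
Implicit Types (alpha x y rho eps : R).
Local Notation mu := (@lebesgue_measure R).

(** The sum of the two powers covers both signs of the exponent: for p >= 0 the
    upper bound on t is used, for p < 0 the lower one. *)
Lemma powR_le_factor (p z t : R) : 0 < z -> 2 * z <= t <= 4 * z ->
  t `^ p <= (2 `^ p + 4 `^ p) * z `^ p.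
Proof.
move=> z0 /andP[zt tz].
have t0 : 0 < t by apply: lt_le_trans zt; rewrite mulr_gt0.
have z0' := ltW z0.
rewrite mulrDl -!powRM//.
have [p0|p0] := leP 0 p.
  apply: (@le_trans _ _ ((4 * z) `^ p)); last by rewrite lerDr powR_ge0.
  by rewrite ge0_ler_powR ?nnegrE// ?ltW// mulr_gt0.
apply: (@le_trans _ _ ((2 * z) `^ p)); last by rewrite lerDl powR_ge0.
rewrite -[p]opprK !(powRN _ (- p)) lef_pV2 ?posrE ?powR_gt0 ?mulr_gt0//.
by rewrite ge0_ler_powR ?nnegrE ?oppr_ge0// ?ltW// mulr_gt0.
Qed.

Definition weinstein_constant alpha : R :=
  Gamma (alpha + 1) /
  (2 `^ (2 * alpha - 1) * Num.sqrt pi * Gamma (alpha + 1 / 2)).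

Lemma weinstein_constant_ge0 alpha : 0 <= weinstein_constant alpha.
Proof.
by rewrite divr_ge0 ?mulr_ge0 ?powR_ge0 ?Gamma_ge0 ?sqrtr_ge0.
Qed.

Lemma weinstein_kernel_ge0 alpha x y rho : 0 <= weinstein_kernel alpha x y rho.
Proof.
rewrite /weinstein_kernel; case: ifP => // _.
by rewrite divr_ge0 ?mulr_ge0 ?powR_ge0 ?Gamma_ge0 ?sqrtr_ge0.
Qed.

(** The second factor is what is lost when the power of a base between
    2 x y and 4 x y is replaced by (x y)^(alpha - 1/2). *)
Definition kernel_constant alpha : R :=
  weinstein_constant alpha * (2 `^ (alpha - 1 / 2) + 4 `^ (alpha - 1 / 2)).

Lemma kernel_constant_ge0 alpha : 0 <= kernel_constant alpha.
Proof. by rewrite mulr_ge0 ?weinstein_constant_ge0 ?addr_ge0 ?powR_ge0. Qed.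

Lemma weinstein_kernelE alpha x y rho : 0 < x -> 0 < y ->
  `|x - y| < rho < x + y ->
  weinstein_kernel alpha x y rho * rho `^ (2 * alpha + 1) =
  weinstein_constant alpha * (x * y) `^ (- (2 * alpha)) *
  (rho * (rho ^+ 2 - (x - y) ^+ 2) `^ (alpha - 1 / 2) *
   ((x + y) ^+ 2 - rho ^+ 2) `^ (alpha - 1 / 2)).
Proof.
move=> x0 y0 /[dup] H /andP[lr ru].
have r0 : 0 < rho by exact: le_lt_trans lr.
have xy0 : 0 < x * y by rewrite mulr_gt0.
rewrite /weinstein_kernel H (powRM _ (ltW xy0) (ltW r0)).
rewrite (@powRD _ rho); last by rewrite (gt_eqF r0) implybT.
rewrite (powRr1 (ltW r0)) powRN /weinstein_constant.
rewrite !invfM.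
have : rho `^ (2 * alpha) != 0 by rewrite gt_eqF// powR_gt0.
have : (x * y) `^ (2 * alpha) != 0 by rewrite gt_eqF// powR_gt0.
move: (2 `^ _)^-1 (Gamma _)^-1 (Num.sqrt _)^-1 => A B C nz1 nz2.
by field; apply/andP.
Qed.

(** The bases rho^2 - (x - y)^2 and (x + y)^2 - rho^2 are positive and add up to
    4 x y, so each is at most 4 x y; the one that is also at least 2 x y has a
    power comparable to (x y)^(alpha - 1/2) and is absorbed into the constant,
    which leaves at most one singular factor.  One of the two alternatives
    always applies. *)
Lemma weinstein_kernel_le alpha x y rho : 0 < x -> 0 < y ->
  `|x - y| < rho < x + y ->
  let D := kernel_constant alpha * (x * y) `^ (- (alpha + 1 / 2)) in
  let W := weinstein_kernel alpha x y rho * rho `^ (2 * alpha + 1) in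
  (2 * (x * y) <= (x + y) ^+ 2 - rho ^+ 2 ->
     W <= D * (rho * (rho ^+ 2 - (x - y) ^+ 2) `^ (alpha - 1 / 2))) /\
  (2 * (x * y) <= rho ^+ 2 - (x - y) ^+ 2 ->
     W <= D * (rho * ((x + y) ^+ 2 - rho ^+ 2) `^ (alpha - 1 / 2))).
Proof.
move=> x0 y0 H D W; rewrite {}/W weinstein_kernelE//.
have [lr ru] := andP H.
have r0 : 0 < rho by exact: le_lt_trans lr.
have xy0 : 0 < x * y by rewrite mulr_gt0.
have lA : (x - y) ^+ 2 < rho ^+ 2.
  by rewrite -real_normK ?num_real// ltr_pXn2r ?nnegrE// ltW.
have Bu : rho ^+ 2 < (x + y) ^+ 2.
  by rewrite ltr_pXn2r ?nnegrE// ltW// addr_gt0.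
have -> : D = weinstein_constant alpha * (x * y) `^ (- (2 * alpha)) *
   ((2 `^ (alpha - 1 / 2) + 4 `^ (alpha - 1 / 2)) * (x * y) `^ (alpha - 1 / 2)).
  rewrite /D /kernel_constant.
  rewrite (_ : - (alpha + 1 / 2) = - (2 * alpha) + (alpha - 1 / 2)); last by lra.
  rewrite (@powRD _ (x * y) (- _)); last by rewrite (gt_eqF xy0) implybT.
  by ring.
have : 0 < rho ^+ 2 - (x - y) ^+ 2 by rewrite subr_gt0.
have : 0 < (x + y) ^+ 2 - rho ^+ 2 by rewrite subr_gt0.
have : (rho ^+ 2 - (x - y) ^+ 2) + ((x + y) ^+ 2 - rho ^+ 2) = 4 * (x * y) by ring.
move: (rho ^+ 2 - _) ((_ + _) ^+ 2 - _) => A B AB B0 A0.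
have := weinstein_constant_ge0 alpha; move: (weinstein_constant _) => K K0.
have KZ0 : 0 <= K * (x * y) `^ (- (2 * alpha)) by rewrite mulr_ge0 ?powR_ge0.
split=> le2; rewrite -[leRHS]mulrA ler_wpM2l//.
  rewrite mulrC ler_wpM2r ?mulr_ge0 ?powR_ge0 ?(ltW r0)//.
  by apply: powR_le_factor => //; lra.
rewrite mulrAC mulrC ler_wpM2r ?mulr_ge0 ?powR_ge0 ?(ltW r0)//.
by apply: powR_le_factor => //; lra.
Qed.

(** * Domination of the Weinstein translation *)

Lemma measurable_enorm d : measurable_fun setT (@enorm R d).
Proof.
rewrite /enorm.
apply: (measurableT_comp (f := @Num.sqrt R)).
  by apply: continuous_measurable_fun; exact: sqrt_continuous.
apply: measurable_funD; last exact: measurable_funX.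
apply: measurable_sum => i; apply: measurable_funX.
by apply: (measurableT_comp (measurable_tnth i)).
Qed.

Lemma measurable_half_ball d eps : measurable (@half_ball R d eps).
Proof.
apply: measurableI; last exact: measurable_half_space.
rewrite (_ : [set x | _] = @enorm R d @^-1` `]-oo, eps]); last first.
  by apply/seteqP; split => x /=; rewrite in_itv.
by rewrite -[X in measurable X]setTI; exact: measurable_enorm.
Qed.

Lemma measurable_weinstein_kernel alpha x y :
  measurable_fun setT (weinstein_kernel alpha x y).
Proof.
rewrite /weinstein_kernel.
apply: measurable_fun_ifT => //=.
  by apply: measurable_and; apply: measurable_fun_ltr.
apply: measurable_funM; [apply: measurable_funM; [apply: measurable_funM => //|]|].
- apply: (measurableT_comp (measurable_powR _)).
  by apply: measurable_funB => //; exact: measurable_funX.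
- apply: (measurableT_comp (measurable_powR _)).
  by apply: measurable_funB => //; exact: measurable_funX.
- under eq_fun do rewrite invfM -powRN.
  apply: measurable_funM => //.
  by apply: (measurableT_comp (measurable_powR _)); exact: measurable_funM.
Qed.

Lemma weinstein_translation_ge0 d alpha eps (x y : Rpoint R d) :
  (0 <= weinstein_translation d alpha (\1_(half_ball d eps)) x y)%E.
Proof.
apply: integral_ge0 => rho _.
by rewrite lee_fin !mulr_ge0 ?weinstein_kernel_ge0 ?powR_ge0.
Qed.

(** The half ball enters only through rho <= eps: dropping the coordinates
    x' - y' reduces everything to a one-dimensional integral. *)
Lemma weinstein_translation_le d alpha eps (x' y' : vect R d.-1)
    (xd yd u : R) (h : R -> R) :
  measurable_fun `]`|xd - yd|, u[ h ->
  (forall rho, `|xd - yd| < rho < u -> 0 <= h rho) ->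
  (forall rho, rho <= eps -> `|xd - yd| < rho < xd + yd ->
     rho < u /\
     weinstein_kernel alpha xd yd rho * rho `^ (2 * alpha + 1) <= h rho) ->
  (weinstein_translation d alpha (\1_(half_ball d eps)) (x', xd) (y', yd) <=
    \int[mu]_(rho in `](`|xd - yd|)%R, u[) (h rho)%:E)%E.
Proof.
set l := `|xd - yd| => mh h0 Wh.
rewrite /weinstein_translation.
have -> : (\int[mu]_(rho in `]l, u[) (h rho)%:E =
           \int[mu]_(rho in `]0%R, +oo[) (((EFin \o h) \_ `]l, u[) rho))%E.
  rewrite -integral_mkcondr setIidr// => t.
  by rewrite /= !in_itv/= andbT => /andP[lt _]; exact: le_lt_trans (normr_ge0 _) lt.
apply: ge0_le_integral => //.
- by move=> rho _; rewrite lee_fin !mulr_ge0 ?weinstein_kernel_ge0 ?powR_ge0.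
- apply/measurable_EFinP; apply: measurable_funTS.
  apply: measurable_funM; last exact: measurable_powR.
  apply: measurable_funM; last exact: measurable_weinstein_kernel.
  have m1 : measurable_fun setT (\1_(half_ball d eps) : Rpoint R d -> R).
    by apply: measurable_indic; exact: measurable_half_ball.
  exact: (measurableT_comp m1 (measurable_pair1 _)).
- apply: measurable_funTS; apply/(measurable_restrictT _ _).1 => //.
  exact/measurable_EFinP.
- move=> rho; rewrite /= in_itv/= andbT => rho0.
  rewrite patchE mem_setE in_itv/=.
  rewrite indicE; case: (boolP (_ \in half_ball d eps)); last first.
    rewrite !mul0r => _; case: ifPn => [/h0|//]; by rewrite lee_fin.
  move=> /set_mem[/= re _]; rewrite mul1r.
  have {}re : rho <= eps.
    apply: le_trans re; rewrite /enorm/=.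
    rewrite -[leLHS](gtr0_norm rho0) -sqrtr_sqr; apply: ler_wsqrtr.
    rewrite lerDr.
    by apply: sumr_ge0 => i _; exact: sqr_ge0.
  have [W0|] := boolP (l < rho < xd + yd).
    have [ru Wle] := Wh _ re W0.
    by move: W0 => /andP[-> _]; rewrite ru lee_fin.
  move=> /negbTE nW; rewrite {1}/weinstein_kernel -/l nW mul0r.
  by case: ifPn => [/h0|//]; rewrite lee_fin.
Qed.

End kernel.

(** * The two regimes *)

Section bounds.
Context {R : realType}.
Implicit Types (alpha eps : R).
Local Notation mu := (@lebesgue_measure R).

(** Here y_d > x_d / 2 on the support, and rho <= eps < x_d / 2 keeps
    (x_d + y_d)^2 - rho^2 above 2 x_d y_d, so only the singularity at
    rho = |x_d - y_d| is met. *)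
Lemma weinstein_translation_le_near d alpha eps (x' y' : vect R d.-1)
    (xd yd : R) : - (1 / 2) < alpha -> 0 < xd -> 0 < yd -> 0 < eps ->
  2 * eps < xd ->
  (weinstein_translation d alpha (\1_(half_ball d eps)) (x', xd) (y', yd) <=
    (kernel_constant alpha * (8 `^ (alpha + 1 / 2) / (2 * (alpha + 1 / 2))) *
     (eps / xd) `^ (2 * alpha + 1))%:E)%E.
Proof.
move=> ha x0 y0 e0 ex.
set q := alpha + 1 / 2; have q0 : 0 < q by rewrite /q; lra.
have e2 : 2 * alpha + 1 = 2 * q by rewrite /q; lra.
have q1 : alpha - 1 / 2 = q - 1 by rewrite /q; lra.
have [ey|ye] := leP eps `|xd - yd|.
  apply: (@le_trans _ _ 0%E); last first.
    rewrite lee_fin mulr_ge0 ?powR_ge0// mulr_ge0 ?kernel_constant_ge0//.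
    by rewrite divr_ge0 ?powR_ge0// mulr_ge0// ltW.
  apply: le_trans.
    apply: (@weinstein_translation_le _ d alpha eps x' y' xd yd `|xd - yd| (cst 0)) => //.
    by move=> rho re /andP[lr _]; have := lt_le_trans lr (le_trans re ey); rewrite ltxx.
  by rewrite set_itvoo0 integral_set0.
have y_half : xd / 2 < yd by move: ye; rewrite ltr_norml; lra.
have xy0 : 0 < xd * yd by rewrite mulr_gt0.
pose k := kernel_constant alpha * (xd * yd) `^ (- q).
have k0 : 0 <= k by rewrite mulr_ge0 ?powR_ge0 ?kernel_constant_ge0.
have sqr_lt t : `|xd - yd| < t -> (xd - yd) ^+ 2 < t ^+ 2.
  move=> lt; rewrite -real_normK ?num_real// ltr_pXn2r ?nnegrE// ltW//.
  exact: le_lt_trans lt.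
(* With upper end 2 eps the open interval contains rho = eps, at the price of a
   larger constant. *)
apply: le_trans.
  apply: (@weinstein_translation_le _ d alpha eps x' y' xd yd (2 * eps)
    (fun t => k * (t * (1 * (t ^+ 2 - (xd - yd) ^+ 2)) `^ (q - 1)))).
  - apply: measurable_funM => //; exact: measurable_mul_powR_sqr.
  - move=> t /andP[lt _].
    rewrite mulr_ge0// mulr_ge0 ?powR_ge0//.
    exact: le_trans (normr_ge0 _) (ltW lt).
  - move=> rho re H; split; first by lra.
    have [+ _] := weinstein_kernel_le alpha x0 y0 H.
    rewrite (mul1r (_ - _)) -q1; apply.
    have r0 : 0 < rho by case/andP: H => lr _; exact: le_lt_trans lr.
    have : rho ^+ 2 <= xd ^+ 2 by rewrite ler_pXn2r ?nnegrE ?ltW//; lra.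
    have := sqr_ge0 yd; nra.
apply: le_trans.
  apply: (@integral_scaled_powR_sqr_le _ k q 1 _ _ _ ((2 * eps) ^+ 2)) => //.
  - by rewrite expr1n.
  - move=> t /andP[lt tu]; rewrite mul1r subr_gt0 sqr_lt//=.
    rewrite lerBlDr (@le_trans _ _ ((2 * eps) ^+ 2)) ?lerDl ?sqr_ge0//.
    rewrite ler_pXn2r ?nnegrE ?ltW//; first exact: le_lt_trans lt.
    by rewrite mulr_gt0.
suff powle : (xd * yd) `^ (- q) * ((2 * eps) ^+ 2) `^ q <=
             8 `^ q * (eps / xd) `^ (2 * alpha + 1).
  rewrite lee_fin.
  have -> : k * (((2 * eps) ^+ 2) `^ q / (2 * q)) = kernel_constant alpha / (2 * q) *
      ((xd * yd) `^ (- q) * ((2 * eps) ^+ 2) `^ q) by rewrite /k; ring.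
  have -> : kernel_constant alpha * (8 `^ q / (2 * q)) * (eps / xd) `^ (2 * alpha + 1) =
      kernel_constant alpha / (2 * q) * (8 `^ q * (eps / xd) `^ (2 * alpha + 1)) by ring.
  by rewrite ler_wpM2l// divr_ge0 ?kernel_constant_ge0// mulr_ge0// ltW.
have ex0 : 0 <= eps / xd by rewrite divr_ge0 ?ltW.
rewrite e2 powRrM -[2]/(2%:R) powR_mulrn//.
rewrite powRN ler_pdivrMl ?powR_gt0//.
have z0 := ltW xy0; have s0 := sqr_ge0 (eps / xd).
have es0 : 0 <= 8 * (eps / xd) ^+ 2 by rewrite mulr_ge0.
rewrite -(powRM _ (ler0n _ 8) s0) -(powRM _ z0 es0).
rewrite ge0_ler_powR ?nnegrE ?sqr_ge0 ?(ltW q0) ?(mulr_ge0 z0 es0)//.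
have -> : xd * yd * (8 * (eps / xd) ^+ 2) = 8 * eps ^+ 2 * (yd / xd).
  by field; rewrite gt_eqF.
have : 1 / 2 <= yd / xd by rewrite ler_pdivlMr//; lra.
by have := sqr_ge0 eps; nra.
Qed.

(** The bound does not depend on eps: the integral of the kernel over the whole
    of ]|x_d - y_d|, x_d + y_d[ is scale invariant.  The two pieces are added so
    that the integrand need not be split at the point where the bases are
    equal. *)
Lemma weinstein_translation_le_far d alpha eps (x' y' : vect R d.-1)
    (xd yd : R) : - (1 / 2) < alpha -> 0 < xd -> 0 < yd ->
  (weinstein_translation d alpha (\1_(half_ball d eps)) (x', xd) (y', yd) <=
    (kernel_constant alpha * (4 `^ (alpha + 1 / 2) / (alpha + 1 / 2)))%:E)%E.
Proof.
move=> ha x0 y0.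
set q := alpha + 1 / 2; have q0 : 0 < q by rewrite /q; lra.
have q1 : alpha - 1 / 2 = q - 1 by rewrite /q; lra.
have xy0 : 0 < xd * yd by rewrite mulr_gt0.
pose k := kernel_constant alpha * (xd * yd) `^ (- q).
have k0 : 0 <= k by rewrite mulr_ge0 ?powR_ge0 ?kernel_constant_ge0.
have sqrs t : `|xd - yd| < t < xd + yd ->
    (xd - yd) ^+ 2 < t ^+ 2 < (xd + yd) ^+ 2.
  move=> /andP[lt tu]; have t0 : 0 < t by exact: le_lt_trans lt.
  by rewrite -real_normK ?num_real// !ltr_pXn2r ?nnegrE ?lt//= ltW// addr_gt0.
pose h s a (t : R) := k * (t * (s * (t ^+ 2 - a)) `^ (q - 1)).
have h0 s a t : `|xd - yd| < t < xd + yd -> 0 <= h s a t.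
  move=> /andP[lt _]; rewrite mulr_ge0// mulr_ge0 ?powR_ge0//.
  exact: le_trans (normr_ge0 _) (ltW lt).
apply: le_trans.
  apply: (@weinstein_translation_le _ d alpha eps x' y' xd yd (xd + yd)
    (fun t => h 1 ((xd - yd) ^+ 2) t + h (-1) ((xd + yd) ^+ 2) t)).
  - by apply: measurable_funD; apply: measurable_funM => //; exact: measurable_mul_powR_sqr.
  - by move=> t lt; rewrite addr_ge0 ?h0.
  - move=> rho _ H; split; first by case/andP: H.
    have [le1 le2] := weinstein_kernel_le alpha x0 y0 H.
    have [le3|lt3] := leP (2 * (xd * yd)) ((xd + yd) ^+ 2 - rho ^+ 2).
      apply: (@le_trans _ _ (h 1 ((xd - yd) ^+ 2) rho)); last by rewrite lerDl h0.
      by rewrite /h (mul1r (_ - _)) -q1; exact: le1.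
    apply: (@le_trans _ _ (h (-1) ((xd + yd) ^+ 2) rho)); last by rewrite lerDr h0.
    by rewrite /h mulN1r opprB -q1; apply: le2; lra.
have hle s a : s ^+ 2 = 1 ->
    (forall t, `|xd - yd| < t < xd + yd -> 0 < s * (t ^+ 2 - a) <= 4 * (xd * yd)) ->
    (\int[mu]_(t in `](`|xd - yd|)%R, (xd + yd)%R[) (h s a t)%:E <=
     (kernel_constant alpha * (4 `^ q / (2 * q)))%:E)%E.
  move=> s1 sM; apply: le_trans.
    by apply: integral_scaled_powR_sqr_le k0 q0 s1 _ sM.
  rewrite lee_fin /k (powRM _ _ (ltW xy0))// powRN.
  have zq0 : (xd * yd) `^ q != 0 by rewrite gt_eqF// powR_gt0.
  rewrite le_eqVlt; apply/orP; left; apply/eqP.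
  by field; rewrite zq0 gt_eqF.
under eq_integral do rewrite EFinD.
rewrite ge0_integralD//; last 4 first.
- by move=> t; rewrite /= in_itv/= lee_fin => /h0.
- by apply/measurable_EFinP; apply: measurable_funM => //; exact: measurable_mul_powR_sqr.
- by move=> t; rewrite /= in_itv/= lee_fin => /h0.
- by apply/measurable_EFinP; apply: measurable_funM => //; exact: measurable_mul_powR_sqr.
have -> : kernel_constant alpha * (4 `^ q / q) =
   kernel_constant alpha * (4 `^ q / (2 * q)) +
   kernel_constant alpha * (4 `^ q / (2 * q)).
  by field; rewrite gt_eqF.
rewrite EFinD; apply: leeD; apply: hle.
- by rewrite expr1n.
- by move=> t /sqrs; lra.
- by rewrite sqrrN expr1n.
- by move=> t /sqrs; lra.
Qed.

End bounds.

Theorem lemma3p2 (R : realType) (d : nat) (alpha : R)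
  (hd : (2 <= d)%N) (halpha : - (1 / 2) < alpha)
  (halphad : d%:R / 2 - 1 < alpha) :
  exists2 c : R, 0 < c &
    forall (x : Rpoint R d) (eps : R), half_space d x -> 0 < eps ->
      {ae nu d alpha, forall y : Rpoint R d, half_space d y ->
        (0 <= weinstein_translation d alpha (\1_(half_ball d eps)) x
                (vopp y.1, y.2)
           <= (c * (eps / (x.2 : R)) `^ (2 * alpha + 1))%:E)%E}.
Proof.
set q := alpha + 1 / 2; have q0 : 0 < q by rewrite /q; lra.
have e2 : 2 * alpha + 1 = 2 * q by rewrite /q; lra.
have kc0 := kernel_constant_ge0 alpha.
(* 16^q = 4^q * 4^q: the factor 4^q of the far regime, divided by the lower bound
   4^(-q) of (eps / xd)^(2 q) in that regime. *)
have c0 : 0 <= kernel_constant alpha * (16 `^ q / q).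
  by rewrite mulr_ge0// divr_ge0 ?powR_ge0// ltW.
exists (kernel_constant alpha * (16 `^ q / q) + 1); first by lra.
move=> [x' xd] eps /= x0 eps0; apply: aeW => -[y' yd] y0.
rewrite weinstein_translation_ge0/=.
have P0 : 0 <= (eps / xd) `^ (2 * alpha + 1) by exact: powR_ge0.
have [ex|xe] := ltP (2 * eps) xd.
  apply: le_trans (weinstein_translation_le_near _ _ halpha x0 y0 eps0 ex) _.
  rewrite lee_fin ler_wpM2r// ler_wpDr// ler_wpM2l//.
  rewrite -/q invfM mulrA ler_wpM2r ?invr_ge0 ?(ltW q0)//.
  have p8 : 8 `^ q <= 16 `^ q :> R by rewrite ge0_ler_powR ?nnegrE ?ler_nat// ltW.
  by have := powR_ge0 (8 : R) q; lra.
apply: le_trans (weinstein_translation_le_far _ _ _ halpha x0 y0) _.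
rewrite lee_fin -/q.
apply: (@le_trans _ _ (kernel_constant alpha * (16 `^ q / q) *
                       (eps / xd) `^ (2 * alpha + 1))); last first.
  by rewrite ler_wpM2r// lerDl.
rewrite -mulrA ler_wpM2l// mulrAC ler_wpM2r ?invr_ge0 ?(ltW q0)//.
have ex0 : 0 <= eps / xd by rewrite divr_ge0 ?ltW.
have s0 := sqr_ge0 (eps / xd).
rewrite e2 powRrM -[2]/(2%:R) powR_mulrn// -(powRM _ (ler0n _ 16) s0).
rewrite ge0_ler_powR ?nnegrE ?(ltW q0) ?(mulr_ge0 (ler0n _ 16) s0)//.
have : 1 / 2 <= eps / xd by rewrite ler_pdivlMr//; lra.
by nra.
Qed.
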